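(* Let $U$ be a connected subset of $\mathbb{Z}^d$ which is included in a half-space. Then every bounded harmonic function of $\Delta_U$ on $U$ is zero, i.e., every bounded $f:U\to\mathbb{R}$ with $\Delta_Uf=0$ on $U$ vanishes identically.
   Context: $\mathbb{Z}^d$ carries the standard nearest neighbor graph structure ($x,y$ adjacent iff $|x-y|=1$); connectedness of $U$ is with respect to the induced nearest neighbor graph on $U$. A half-space of $\mathbb{Z}^d$ is a set of the form $\{x\in\mathbb{Z}^d\mid x_j\ge0\}$ for some $j\in\{1,\dots,d\}$. For $U\subseteq\mathbb{Z}^d$, $\Delta_U$ is the restriction to $U$, with Dirichlet boundary conditions, of $\Delta f(x)=\sum_{|y-x|=1}(f(x)-f(y))$, i.e., for $f:U\to\mathbb{R}$ and $x\in U$, $$\Delta_Uf(x)=\sum_{y\in U,\,|x-y|=1}(f(x)-f(y))+\#\{y\in\mathbb{Z}^d\setminus U\mid|x-y|=1\}\,f(x).$$ *)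

(* Defs.v *)
From mathcomp Require Import all_boot all_order all_algebra finmap.
From mathcomp Require Import all_classical all_reals all_analysis.

Set Implicit Arguments.
Unset Strict Implicit.
Unset Printing Implicit Defensive.

Import Order.TTheory GRing.Theory Num.Theory.
Import numFieldNormedType.Exports.

Local Open Scope classical_set_scope.
Local Open Scope ring_scope.

Definition lattice (d : nat) := 'rV[int]_d.

(* The l^1 length, rather than the sup norm which is the default on matrices;
   at value 1 it agrees with the Euclidean length. *)
Definition dist1 (d : nat) (x y : lattice d) : int :=
  \sum_(i < d) `|x ord0 i - y ord0 i|.

Definition adj (d : nat) : rel (lattice d) := fun x y => dist1 x y == 1.

(* Paths must stay inside U: connectedness of the induced subgraph. *)
Definition graph_connected (d : nat) (U : set (lattice d)) : Prop :=
  forall x y, U x -> U y ->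
  exists p : seq (lattice d),
    [/\ path (@adj d) x p, last x p = y & forall z, z \in p -> U z].

Definition half_space (d : nat) (j : 'I_d) : set (lattice d) :=
  [set x | 0 <= x ord0 j].

Definition is_half_space (d : nat) (H : set (lattice d)) : Prop :=
  exists j : 'I_d, H = half_space j.

Definition inner_nbr (d : nat) (U : set (lattice d)) (x : U) : set U :=
  [set y : U | adj (val x) (val y)].

Definition outer_nbr (d : nat) (U : set (lattice d)) (x : U) :
    set (lattice d) :=
  [set y | ~ U y /\ adj (val x) y].

(* \sum_(_ \in _) and fset_set have default values on infinite sets; the lemmas
   below show that inner_nbr x and outer_nbr x are always finite. *)
Definition dirichlet_laplacian (R : realType) (d : nat) (U : set (lattice d))
    (f : U -> R) (x : U) : R :=
  \sum_(y \in inner_nbr x) (f x - f y) + #|` fset_set (outer_nbr x)|%:R * f x.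

Lemma finite_adj (d : nat) (x : lattice d) : finite_set [set y | adj x y].
Proof.
pose g (v : 'rV['I_3]_d) : lattice d := x + \row_i ((v ord0 i : nat)%:Z - 1).
apply: (@sub_finite_set _ _ (g @` setT)); last first.
  by apply: finite_image; exact: finite_finset.
move=> y /eqP xy.
have le1 i : `|x ord0 i - y ord0 i| <= 1.
  by rewrite -xy /dist1 (bigD1 i) //= lerDl sumr_ge0.
exists (\row_i inord (absz (y ord0 i - x ord0 i + 1))) => //.
apply/rowP => i; rewrite !mxE.
have := le1 i; rewrite distrC ler_norml => /andP[lo hi].
have ge0 : 0 <= y ord0 i - x ord0 i + 1 by rewrite -lerBlDr sub0r.
have lt3 : y ord0 i - x ord0 i + 1 < 3 by rewrite -ltrBrDr (le_lt_trans hi).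
rewrite inordK; last by rewrite -ltz_nat gez0_abs.
by rewrite gez0_abs // addrK addrC subrK.
Qed.

Lemma finite_inner_nbr (d : nat) (U : set (lattice d)) (x : U) :
  finite_set (inner_nbr x).
Proof.
apply: (@finite_preimage _ _ [set y | adj (val x) y] val).
  by move=> ? ? _ _; exact: val_inj.
exact: finite_adj.
Qed.

Lemma finite_outer_nbr (d : nat) (U : set (lattice d)) (x : U) :
  finite_set (outer_nbr x).
Proof. by apply: sub_finite_set (finite_adj (val x)) => y []. Qed.

(* Main.v *)
(* Extend f by zero and let x_j >= 0 be the half-space. With t = x_j + 1 the
   quadratic V_N(x) = |x|^2 + (d + 1) t (N + 2 - t) satisfies Delta V_N = 2 > 0,
   is nonnegative for 0 <= t <= N + 2, and is at least N^2 on the part of the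
   boundary of the box |x_i| <= N that meets the half-space. If f <= M on U, the
   maximum principle on the box thus gives N^2 f <= M V_N; as V_N(x) grows only
   linearly in N at a fixed x, letting N tend to infinity yields f <= 0. The
   same applies to -f. *)

Require Import Defs.
From mathcomp Require Import all_boot all_order all_algebra finmap.
From mathcomp Require Import all_classical all_reals all_analysis.
From mathcomp Require Import zify ring lra.

Set Implicit Arguments.
Unset Strict Implicit.
Unset Printing Implicit Defensive.

Import Order.TTheory GRing.Theory Num.Theory.
Import numFieldNormedType.Exports.

Local Open Scope classical_set_scope.
Local Open Scope ring_scope.

(** * Neighbours of a lattice point *)

(* The 2d neighbours of x: x + e_i for (i, false), x - e_i for (i, true). *)
Definition step (d : nat) (x : lattice d) (p : 'I_d * bool) : lattice d :=
  x + \row_i ((i == p.1)%:R * (-1) ^+ p.2).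

Lemma adjP (d : nat) (x y : lattice d) :
  adj x y <-> exists p, y = step x p.
Proof.
rewrite /adj /dist1; split=> [/eqP xy|[[i b] ->]].
  have [i xyi] : exists i, x ord0 i != y ord0 i.
    apply/existsP; rewrite -negb_forall; apply/negP => /forallP eqxy.
    by move: xy; rewrite big1 // => i _; rewrite (eqP (eqxy i)) subrr normr0.
  have rest_ge0 : 0 <= \sum_(k < d | k != i) `|x ord0 k - y ord0 k|.
    by apply: sumr_ge0.
  move: xy; rewrite (bigD1 i) //= => xy.
  (* Integrality: coordinate [i] already uses up at least 1 of the total length 1. *)
  have rest0 : \sum_(k < d | k != i) `|x ord0 k - y ord0 k| = 0.
    move: xyi xy rest_ge0; rewrite -subr_eq0 -normr_gt0.
    move: (\sum_(_ < d | _) _) `|_| => r s; lia.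
  have eqxy k : k != i -> x ord0 k = y ord0 k.
    move=> ki; apply/eqP; rewrite -subr_eq0 -normr_eq0.
    by rewrite (psumr_eq0P (fun k _ => normr_ge0 _) rest0 ki).
  exists (i, (y ord0 i < x ord0 i)); apply/rowP => k; rewrite !mxE /=.
  have [->|/eqxy ->] := eqVneq k i; last by rewrite mul0r addr0.
  move: xy; rewrite mul1r rest0 addr0.
  move: (x ord0 i) (y ord0 i) => a b; case: ltP => ab /=; rewrite ?expr1 ?expr0; lia.
rewrite (bigD1 i) //= big1 ?addr0 => [|k ki]; last first.
  by rewrite !mxE /= (negPf ki) mul0r addr0 subrr normr0.
by rewrite !mxE /= eqxx mul1r distrC addrAC subrr add0r normr_sign.
Qed.

Lemma step_inj (d : nat) (x : lattice d) : injective (step x).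
Proof.
move=> [i b] [k c] /addrI /rowP /(_ i); rewrite !mxE /= eqxx mul1r.
have [<-|_] := eqVneq i k; last first.
  by rewrite mul0r => /eqP; rewrite signr_eq0.
by rewrite mul1r => /eqP; rewrite (inj_eq signr_inj) => /eqP ->.
Qed.

(** * Zero extension and the Laplacian of the whole lattice *)

Definition lap (R : nzRingType) (d : nat) (F : lattice d -> R) (x : lattice d) :=
  \sum_(p : 'I_d * bool) (F x - F (step x p)).

Definition extend0 (R : nmodType) (d : nat) (U : set (lattice d)) (f : U -> R)
  (x : lattice d) : R := oapp f 0 (insub x).

Lemma extend0_val (R : nmodType) (d : nat) (U : set (lattice d)) (f : U -> R)
  (x : U) : extend0 f (val x) = f x.
Proof. by rewrite /extend0 valK. Qed.

Lemma extend0_out (R : nmodType) (d : nat) (U : set (lattice d)) (f : U -> R)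
  (x : lattice d) : ~ U x -> extend0 f x = 0.
Proof. by move=> Ux; rewrite /extend0 insubN //; apply/negP; rewrite inE. Qed.

(** A neighbour outside [U] contributes [f x - 0 = f x], so these neighbours together give exactly
    the Dirichlet boundary term. *)
Lemma dirichlet_laplacianE (R : realType) (d : nat) (U : set (lattice d))
    (f : U -> R) (x : U) :
  dirichlet_laplacian f x = lap (extend0 f) (val x).
Proof.
pose N := [set y | adj (val x) y].
have bijN : set_bij [set: 'I_d * bool] N (step (val x)).
  split=> [p _ /=|p q _ _|y /= /adjP[p ->]]; first by apply/adjP; exists p.
    exact: step_inj.
  by exists p.
have bijI : set_bij (inner_nbr x) (N `&` U) val.
  split=> [y /= xy|y z _ _|y [xy Uy]].
    by split=> //; have := valP y; rewrite inE.
  exact: val_inj.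
  by exists (SigSub (mem_set Uy)).
have -> : lap (extend0 f) (val x) =
    \sum_(y \in N) (extend0 f (val x) - extend0 f y).
  rewrite (reindex_fsbig _ _ _ _ bijN) fsbig_finite //; last exact: finite_finset.
  rewrite /lap; apply: perm_big; apply: uniq_perm; rewrite ?index_enum_uniq ?fset_uniq //.
  move=> p; rewrite mem_index_enum in_fset_set; last exact: finite_finset.
  by rewrite in_setT.
rewrite (fsbigID U) /=; last exact: finite_adj.
rewrite (reindex_fsbig _ _ _ _ bijI); congr (_ + _).
  by apply: eq_fsbigr => y _; rewrite !extend0_val.
have -> : N `&` ~` U = outer_nbr x by apply/seteqP; split=> y [].
rewrite extend0_val (eq_fsbigr (fun=> f x)) => [|y]; last first.
  by rewrite inE => -[Uy _]; rewrite (extend0_out _ Uy) subr0.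
rewrite fsbig_finite; last exact: finite_outer_nbr.
by rewrite big_const_seq count_predT iter_addr_0 mulr_natl.
Qed.

(** * Maxima over a box *)

Lemma box_argmax (R : realFieldType) (d : nat) (F : lattice d -> R)
    (P : set (lattice d)) (N : nat) (x0 : lattice d) :
  P x0 -> (forall i, `|x0 ord0 i| <= N%:Z) ->
  exists x, [/\ P x, (forall i, `|x ord0 i| <= N%:Z) &
    forall y, P y -> (forall i, `|y ord0 i| <= N%:Z) -> F y <= F x].
Proof.
move=> Px0 x0N.
(* Shifting digits 0, ..., 2N to -N, ..., N enumerates the box by a finite type. *)
pose pt (k : 'rV['I_(N + N).+1]_d) : lattice d :=
  \row_i ((k ord0 i : nat)%:Z - N%:Z).
have ptN k i : `|pt k ord0 i| <= N%:Z.
  by rewrite mxE; have := ltn_ord (k ord0 i); lia.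
have ptP (y : lattice d) :
    (forall i, `|y ord0 i| <= N%:Z) -> exists k, y = pt k.
  move=> yN; exists (\row_i inord (absz (y ord0 i + N%:Z))).
  apply/rowP => i; rewrite !mxE; move: (yN i); move: (y ord0 i) => a aN.
  by rewrite inordK; lia.
have [k0 x0E] := ptP x0 x0N.
have Pk0 : `[< P (pt k0) >] by apply/asboolP; rewrite -x0E.
have [k /asboolP Pk kmax] :=
  @arg_maxP _ _ _ k0 (fun k => `[< P (pt k) >]) (F \o pt) Pk0.
exists (pt k); split=> // y Py /ptP[l yE]; rewrite yE; apply: kmax.
by apply/asboolP; rewrite -yE.
Qed.

(** * The barrier V_N *)

(** The shift in [t] makes it vanish on the layer x_j = -1, the only one outside the half-space that
    a single step can reach. *)
Definition barrier (R : nzRingType) (d : nat) (j : 'I_d) (N : R)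
    (x : lattice d) : R :=
  let t := (x ord0 j)%:~R + 1 in
  \sum_i (x ord0 i)%:~R ^+ 2 + d.+1%:R * (t * (N + 2 - t)).

(** The increment is split into a part odd in the sign of the step, which cancels between opposite
    steps, and an even part. *)
Lemma barrier_step (R : comNzRingType) (d : nat) (j i : 'I_d) (b : bool) (N : R)
    (x : lattice d) :
  barrier j N (step x (i, b)) = barrier j N x
    + (-1) ^+ b * (2 * (x ord0 i)%:~R
         + d.+1%:R * (i == j)%:R * (N - 2 * (x ord0 j)%:~R))
    + (1 - d.+1%:R * (i == j)%:R).
Proof.
have sqr_sgn : ((-1) ^+ b) ^+ 2 = 1 :> R by rewrite sqrr_sign.
rewrite /barrier !mxE /= rmorphD rmorphM rmorphMn rmorph_sign /=.
have -> : \sum_k ((step x (i, b)) ord0 k)%:~R ^+ 2 =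
    \sum_k (x ord0 k)%:~R ^+ 2 + (-1) ^+ b * (2 * (x ord0 i)%:~R) + 1 :> R.
  rewrite (bigD1 i) //= [in RHS](bigD1 i) //= !mxE /= eqxx mul1r.
  rewrite (eq_bigr (fun k => (x ord0 k)%:~R ^+ 2)) => [|k /negPf ki]; last first.
    by rewrite !mxE /= ki mul0r addr0.
  rewrite rmorphD rmorph_sign /=.
  (* [ring] treats [s] as an indeterminate, so [s ^+ 2] is substituted for 1 by hand. *)
  move: sqr_sgn; set s := (-1) ^+ b => s2; rewrite -[X in _ = _ + X]s2; ring.
move: sqr_sgn; set s := (-1) ^+ b; rewrite eq_sym.
move: (\sum_k _) ((x ord0 i)%:~R) ((x ord0 j)%:~R) d.+1%:R => S xi xj D s2.
case: (i == j) => /=; rewrite ?mulr1n ?mulr0n.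
  rewrite -[X in _ = _ + (1 - _ * X)]s2; ring.
ring.
Qed.

Lemma lap_barrier (R : comNzRingType) (d : nat) (j : 'I_d) (N : R)
    (x : lattice d) :
  lap (barrier j N) x = 2.
Proof.
rewrite /lap -(pair_bigA _ (fun i b => _ - barrier j N (step x (i, b)))) /=.
(* The pair of steps along axis [i] gives -2, plus 2(d + 1) if i = j. The total is 2(d + 1) - 2d =
   2, whence the factor d + 1 in the barrier. *)
rewrite (eq_bigr (fun i => 2 * d.+1%:R * (i == j)%:R - 2)) => [|i _].
  rewrite sumrB -mulr_sumr (bigD1 j) //= big1 => [|i /negPf -> //].
  by rewrite eqxx sumr_const card_ord -natr1 -[2 *+ d]mulr_natr /= mulr1n; ring.
by rewrite big_bool /= !barrier_step expr0 expr1; ring.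
Qed.

Lemma barrier_ge (R : realFieldType) (d : nat) (j : 'I_d) (N : nat)
    (x : lattice d) :
  -1 <= x ord0 j <= N%:Z -> \sum_i (x ord0 i)%:~R ^+ 2 <= barrier j N%:R x :> R.
Proof.
move=> /andP[xlo xhi]; rewrite /barrier lerDl mulr_ge0 // mulr_ge0 //.
  by rewrite -(ler_int R) in xlo; lra.
by rewrite -(ler_int R) in xhi; lra.
Qed.

(** * Maximum principle and the limit in N *)

(** Otherwise [w] has a positive maximum over the part of [U] in the box. There [lap w] is
    nonnegative, yet it equals -2M. *)
Lemma harmonic_le_barrier (R : realFieldType) (d : nat) (j : 'I_d)
    (U : set (lattice d)) (g : lattice d -> R) (M : R) (N : nat)
    (x0 : lattice d) :
  U `<=` half_space j -> 0 < M ->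
  (forall x, ~ U x -> g x = 0) -> (forall x, g x <= M) ->
  (forall x, U x -> lap g x = 0) -> U x0 ->
  (forall i, `|x0 ord0 i| <= N%:Z) ->
  g x0 * N%:R ^+ 2 <= M * barrier j N%:R x0.
Proof.
move=> Uhalf M0 g0 gM gharm Ux0 x0N; rewrite leNgt; apply/negP => gt_barrier.
pose w x := g x * N%:R ^+ 2 - M * barrier j N%:R x.
have [x [Ux xN xmax]] := box_argmax w Ux0 x0N.
have wx_gt0 : 0 < w x by apply: lt_le_trans (xmax _ Ux0 x0N); rewrite subr_gt0.
have xj0 : 0 <= x ord0 j := Uhalf _ Ux.
(* If |x_i| = N, the squares alone give V_N >= N^2, hence w <= 0. So the maximum is interior and its
   neighbours stay in the box. *)
have xlt i : `|x ord0 i| < N%:Z.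
  rewrite lt_neqAle xN andbT; apply: contraTneq wx_gt0 => xiN.
  rewrite -leNgt subr_le0 (le_trans (ler_wpM2r (sqr_ge0 _) (gM x))) //.
  rewrite ler_pM2l // (le_trans _ (barrier_ge _ _)) //; last first.
    by have := xN j; lia.
  rewrite (bigD1 i) //= -[X in X <= _]addr0 lerD ?sumr_ge0 // => [|k _].
    by rewrite -[_%:~R ^+ 2]real_normK ?num_real // -intr_norm xiN.
  exact: sqr_ge0.
have stepN p i : `|step x p ord0 i| <= N%:Z.
  rewrite !mxE; move: (xlt i); move: (x ord0 i) => a.
  by case: p => k b /=; case: eqP => _; case: b; rewrite /= ?expr1 ?expr0; lia.
have stepj p : -1 <= step x p ord0 j.
  rewrite !mxE; move: xj0; move: (x ord0 j) => a.
  by case: p => k b /=; case: eqP => _; case: b; rewrite /= ?expr1 ?expr0; lia.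
(* Outside [U], [g] vanishes and the barrier is nonnegative, so w <= 0 < w(x). *)
have wstep p : w (step x p) <= w x.
  have [Uy|nUy] := pselect (U (step x p)); first exact: xmax.
  apply: le_trans (ltW wx_gt0); rewrite /w g0 // mul0r sub0r oppr_le0.
  rewrite mulr_ge0 ?(ltW M0) // (le_trans _ (barrier_ge _ _)) ?sumr_ge0 //.
    by move=> i _; exact: sqr_ge0.
  by rewrite stepj; have := stepN p j; lia.
have : 0 <= lap w x by apply: sumr_ge0 => p _; rewrite subr_ge0.
have -> : lap w x = lap g x * N%:R ^+ 2 - M * lap (barrier j N%:R) x.
  rewrite /lap mulr_suml mulr_sumr -sumrB; apply: eq_bigr => p _.
  by rewrite /w; ring.
by rewrite gharm // lap_barrier; lra.
Qed.

Lemma harmonic_le0 (R : archiRealFieldType) (d : nat) (j : 'I_d)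
    (U : set (lattice d)) (g : lattice d -> R) (M : R) :
  U `<=` half_space j -> 0 < M ->
  (forall x, ~ U x -> g x = 0) -> (forall x, g x <= M) ->
  (forall x, U x -> lap g x = 0) -> forall x, g x <= 0.
Proof.
move=> Uhalf M0 g0 gM gharm x; have [Ux|nUx] := pselect (U x); last first.
  by rewrite g0.
rewrite leNgt; apply/negP => gx0.
pose t : R := (x ord0 j)%:~R + 1.
(* At the fixed point x the barrier is the affine function A + B N of N. *)
pose A := \sum_i (x ord0 i)%:~R ^+ 2 + d.+1%:R * (t * (2 - t)).
pose B := d.+1%:R * t.
pose K := M * (`|A| + B) / g x.
(* The maximum puts x in the box, the Archimedean bound gives N > K, and the successor gives N >= 1.
   Then g(x) N^2 > M (|A| + B) N >= M (A + B N). *)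
pose N := (\max_i absz (x ord0 i) + Num.bound `|K|).+1.
have xN i : `|x ord0 i| <= N%:Z.
  have := @leq_bigmax _ (fun i => absz (x ord0 i)) i; rewrite /N; lia.
have := harmonic_le_barrier Uhalf M0 g0 gM gharm Ux xN.
have -> : barrier j N%:R x = A + B * N%:R.
  by rewrite /barrier /A /B -/t; ring.
have N1 : 1 <= N%:R :> R by rewrite ler1n.
have : K < N%:R.
  rewrite (le_lt_trans (ler_norm _)) // (lt_le_trans (archi_boundP (normr_ge0 _))) //.
  by rewrite ler_nat (leq_trans (leq_addl _ _) (leqnSn _)).
rewrite /K ltr_pdivrMr // => KN.
have AN : A <= `|A| * N%:R.
  by rewrite (le_trans (ler_norm A)) // ler_peMr.
apply/negP; rewrite -ltNge expr2 mulrA.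
have : M * (A + B * N%:R) <= M * (`|A| + B) * N%:R.
  by rewrite -mulrA ler_pM2l // mulrDl lerD2r.
move=> /le_lt_trans; apply; rewrite ltr_pM2r ?(lt_le_trans _ N1) //.
by rewrite [g x * _]mulrC.
Qed.

Theorem theorem31 (R : realType) (d : nat) (U : set (lattice d))
    (U_connected : graph_connected U)
    (U_half_space : exists H : set (lattice d), is_half_space H /\ U `<=` H)
    (f : U -> R) (f_bounded : bounded_fun f)
    (f_harmonic : forall x : U, dirichlet_laplacian f x = 0) :
  forall x : U, f x = 0.
Proof.
have [_ [[j ->] Uhalf]] := U_half_space.
(* The bound is taken positive, even for f = 0, so that M V_N has a strictly positive Laplacian. *)
have [M M0 fM] := ex_strict_bound_gt0 f_bounded.
pose g := extend0 f.
have g0 x : ~ U x -> g x = 0 by exact: extend0_out.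
have gM x : `|g x| <= M.
  have [Ux|/g0 ->] := pselect (U x); last by rewrite normr0 ltW.
  by rewrite /g -[x]/(val (SigSub (mem_set Ux))) extend0_val ltW //; exact: fM.
have gharm x : U x -> lap g x = 0.
  move=> Ux; rewrite -[x]/(val (SigSub (mem_set Ux))).
  by rewrite -dirichlet_laplacianE.
have gle0 := harmonic_le0 Uhalf M0 g0 (fun x => ler_normlW (gM x)) gharm.
have gge0 x : - g x <= 0.
  apply: (@harmonic_le0 _ _ j U (fun x => - g x) M) => // [y /g0 ->|y|y Uy].
  - by rewrite oppr0.
  - by rewrite (le_trans (ler_norm _)) // normrN.
  - rewrite -oppr0 -(gharm y Uy) -sumrN; apply: eq_bigr => p _.
    by rewrite opprB opprK addrC.
move=> x; rewrite -(extend0_val f) -/g; apply/eqP.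
by rewrite eq_le gle0 -oppr_le0 gge0.
Qed.
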